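(* Let $n$ be even and let $(C_0,C_1)$ be a partition of the vertex set of the halved $n$-cube $\frac12 H(n)$. For $i=0,1$ let $C'_i=\{(x_1,\ldots,x_{n-1}) : (x_1,\ldots,x_n)\in C_i\}$ be obtained by deleting the last coordinate, so that $(C'_0,C'_1)$ is a partition of the vertex set of the $(n-1)$-cube $H(n-1)$. Then $(C_0,C_1)$ is an equitable partition of $\frac12 H(n)$ with quotient matrix $S$ having eigenvalue $\theta_{n/2}(n)=-n/2$ if and only if $(C'_0,C'_1)$ is an equitable partition of $H(n-1)$ with quotient matrix $S'=\begin{pmatrix} c-1 & n-c\\ c & n-c-1\end{pmatrix}$ for some $c$, and $S=\frac{S'^2-(n-1)\mathrm{Id}}{2}+S'$.
   Context: The $m$-cube $H(m)$ is the graph on all binary words of length $m$, two words adjacent iff they differ in exactly one position. The halved $n$-cube $\frac12 H(n)$ is the graph on the binary words of length $n$ with an even number of ones, two words adjacent iff they differ in exactly two positions. The eigenvalues of $\frac12 H(n)$ are $\theta_i(n)=((n-2i)^2-n)/2$, $i=0,\ldots,\lfloor n/2\rfloor$; for even $n$ the minimum one is $\theta_{n/2}(n)=-n/2$. An equitable $2$-partition of a graph is an ordered partition $(C_0,C_1)$ of the vertex set such that the number of neighbors in $C_j$ of a vertex of $C_i$ is a constant $S_{ij}$; $S=(S_{ij})$ is the quotient matrix, and ''eigenvalue of the partition'' means the eigenvalue of $S$ other than the graph degree. *)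

(* Defs.v *)
From mathcomp Require Import all_boot all_order all_algebra.

Set Implicit Arguments.
Unset Strict Implicit.
Unset Printing Implicit Defensive.

Import Order.TTheory GRing.Theory Num.Theory.
Local Open Scope ring_scope.

Definition word (n : nat) := n.-tuple bool.

Definition hamming_dist (n : nat) (x y : word n) : nat :=
  #|[set i | tnth x i != tnth y i]|.

Definition even_word (n : nat) := {x : word n | ~~ odd (count_mem true x)}.

Definition cube (m : nat) : rel (word m) :=
  [rel x y | hamming_dist x y == 1%N].

Definition halved_cube (n : nat) : rel (even_word n) :=
  [rel x y | hamming_dist (val x) (val y) == 2].

Definition theta (n i : nat) : rat :=
  ((n%:R - 2 * i%:R) ^+ 2 - n%:R) / 2.

Lemma theta_half (n : nat) : ~~ odd n -> theta n n./2 = - n%:R / 2.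
Proof.
move=> n_even; rewrite /theta -natrM mul2n even_halfK //.
by rewrite subrr expr0n sub0r.
Qed.

Definition neighbors_in (V : finType) (e : rel V) (x : V) (A : {set V}) : nat :=
  #|[set y in A | e x y]|.

(* The cells of a partition are nonempty; without this the corresponding row
   of a quotient matrix would be arbitrary. *)
Definition ordered_2partition (V : finType) (C : 'I_2 -> {set V}) : Prop :=
  [/\ forall i, C i != set0,
      [disjoint C 0 & C 1]
    & C 0 :|: C 1 = [set: V]].

Definition equitable_2partition (V : finType) (e : rel V)
    (C : 'I_2 -> {set V}) (S : 'M[rat]_2) : Prop :=
  ordered_2partition C /\
  forall i j x, x \in C i -> (neighbors_in e x (C j))%:R = S i j.

(* The eigenvalue of S other than the degree of the (regular) graph e. *)
Definition partition_eigenvalue (V : finType) (e : rel V)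
    (S : 'M[rat]_2) (a : rat) : Prop :=
  eigenvalue S a /\ forall x, a != (neighbors_in e x [set: V])%:R.

Definition delete_last (n : nat) (x : word n) : word n.-1 :=
  [tuple tnth x (widen_ord (leq_pred n) i) | i < n.-1].

Definition punctured (n : nat) (C : 'I_2 -> {set even_word n}) :
    'I_2 -> {set word n.-1} :=
  fun i => [set delete_last (val x) | x in C i].

Definition punctured_quotient (n : nat) (c : int) : 'M[rat]_2 :=
  let c := c%:~R in let n := n%:R in
  \matrix_(i, j) if i == 0
                 then (if j == 0 then c - 1 else n - c)
                 else (if j == 0 then c else n - c - 1).

(* Main.v *)
(** Identify a vertex of the cube H(n-1) with the even word of length n
    extending it.  Moving along an edge of H(n-1) then means flipping a
    coordinate i < n together with the last one; let B (below [flip_sum]) be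
    the sum of these moves over all i, the choice i = n contributing the
    identity, so that B = A + 1 for the adjacency operator A of H(n-1).
    Composing two moves flips coordinates i and j, whence B^2 = 2 A' + n for
    the adjacency operator A' of the halved n-cube.  The eigenspace of A' for
    -n/2 is therefore the kernel of B^2, which is the kernel of B since B is
    symmetric.  Either side of the equivalence says that B maps the indicator
    of C_0 to a constant, namely c. *)
Require Import Defs.
From mathcomp Require Import all_boot all_order all_algebra.
From mathcomp Require Import ring lra.

Set Implicit Arguments.
Unset Strict Implicit.
Unset Printing Implicit Defensive.

Import Order.TTheory GRing.Theory Num.Theory.
Local Open Scope ring_scope.

(** * Parity and flips of two coordinates *)

Lemma odd_count_true (n : nat) (x : word n) :
  odd (count_mem true x) = \big[addb/false]_(k < n) tnth x k.
Proof.
rewrite -sum1_count big_tuple big_mkcond (big_morph odd oddD erefl).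
by apply: eq_bigr => k _; rewrite /=; case: (tnth x k).
Qed.

Lemma big_addb_eq (n : nat) (i : 'I_n) : \big[addb/false]_(k < n) (k == i) = true.
Proof. by rewrite (bigD1 i) //= eqxx big1 // => k /negbTE. Qed.

(** The two toggles cancel when [i = j], so parity is kept without assuming the positions
    distinct. *)
Definition flip_word (n : nat) (i j : 'I_n) (x : word n) : word n :=
  [tuple tnth x k (+) (k == i) (+) (k == j) | k < n].

Lemma flip_word_even (n : nat) (i j : 'I_n) (x : even_word n) :
  ~~ odd (count_mem true (flip_word i j (val x))).
Proof.
have := valP x; rewrite !odd_count_true.
under [in X in _ -> X]eq_bigr do rewrite tnth_mktuple.
by rewrite !big_split /= !big_addb_eq; case: (\big[_/_]_(k < n) _).
Qed.

Definition flip (n : nat) (i j : 'I_n) (x : even_word n) : even_word n :=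
  Sub (flip_word i j (val x)) (flip_word_even i j x).

Lemma tnth_flip (n : nat) (i j : 'I_n) (x : even_word n) (k : 'I_n) :
  tnth (val (flip i j x)) k = tnth (val x) k (+) (k == i) (+) (k == j).
Proof. by rewrite tnth_mktuple. Qed.

Lemma even_word_eqP (n : nat) (x y : even_word n) :
  (forall k, tnth (val x) k = tnth (val y) k) -> x = y.
Proof. by move=> xy; apply/val_inj/eq_from_tnth. Qed.

Lemma flip_id (n : nat) (i : 'I_n) (x : even_word n) : flip i i x = x.
Proof. by apply: even_word_eqP => k; rewrite tnth_flip addbK. Qed.

Lemma flip_flip (n : nat) (i j k : 'I_n) (x : even_word n) :
  flip j k (flip i k x) = flip i j x.
Proof.
apply: even_word_eqP => l; rewrite !tnth_flip.
by case: (tnth _ l); case: (l == i); case: (l == j); case: (l == k).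
Qed.

Lemma flipK (n : nat) (i j : 'I_n) : involutive (@flip n i j).
Proof. by move=> x; rewrite flip_flip flip_id. Qed.

Lemma flip_eqE (n : nat) (i j : 'I_n) (x y : even_word n) : i != j ->
  (flip i j x == y) =
  ([set k | tnth (val x) k != tnth (val y) k] == [set i; j]).
Proof.
move=> ij; apply/eqP/eqP => [<-|/setP D].
  apply/setP => k; rewrite !inE tnth_flip.
  have [->|_] := eqVneq k i; first by rewrite (negbTE ij); case: (tnth _ i).
  by case: (tnth _ k); case: (k == j).
apply: even_word_eqP => k; rewrite tnth_flip.
have := D k; rewrite !inE.
have [->|_] := eqVneq k i; first by rewrite (negbTE ij); do 2!case: (tnth _ _).
by case: (k == j); do 2!case: (tnth _ _).
Qed.

(** The two orders of the pair of differing positions are the only solutions; this is where the 2 in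
    B^2 = 2 A' + n comes from. *)
Lemma card_flip_eq (n : nat) (x y : even_word n) :
  #|[set p : 'I_n * 'I_n | (p.1 != p.2) && (flip p.1 p.2 x == y)]| =
  (halved_cube x y).*2.
Proof.
rewrite /halved_cube /= /hamming_dist.
set D := [set k | _].
have E : [set p : 'I_n * 'I_n | (p.1 != p.2) && (flip p.1 p.2 x == y)] =
         [set p | (p.1 != p.2) && (D == [set p.1; p.2])].
  by apply/setP => p; rewrite !inE; case: eqVneq => //= pp; rewrite flip_eqE.
move: D E => D -> ; have [/cards2P [a [b [ab ->]]]|D2] := boolP (#|D| == 2).
  rewrite (_ : [set p | _] = [set (a, b); (b, a)]).
    by rewrite cards2 xpair_eqE (negbTE ab).
  apply/setP => -[i j]; rewrite !inE !xpair_eqE /=.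
  apply/andP/orP => [[ij /eqP/setP E]|].
    (* Each of [a] and [b] is [i] or [j]; of the four cases, two force [a = b] and are absurd. *)
    have := E i; have := E j; have := E a; have := E b; rewrite !inE !eqxx !orbT.
    rewrite /= => /esym/orP[]/eqP Eb /esym/orP[]/eqP Ea _ _; subst.
    - by rewrite eqxx in ab.
    - by right; rewrite !eqxx.
    - by left; rewrite !eqxx.
    - by rewrite eqxx in ab.
  by case=> /andP[/eqP-> /eqP->]; split; rewrite // 1?eq_sym // setUC.
apply/eqP; rewrite cards_eq0; apply/eqP/setP => p; rewrite !inE.
apply/negbTE; apply: contra D2 => /andP[pp /eqP->].
by rewrite cards2 pp.
Qed.

(** * The operator B: its square, symmetry and kernel *)

Definition flip_sum (m : nat) (f : even_word m.+1 -> rat) (x : even_word m.+1) :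
  rat := \sum_i f (flip i ord_max x).

(** In a composite of two moves the last coordinate cancels, leaving [flip i j]. Diagonal pairs act
    as the identity; the others are grouped by the word they reach. *)
Lemma flip_sum_sqr (m : nat) (f : even_word m.+1 -> rat) (x : even_word m.+1) :
  flip_sum (flip_sum f) x =
  m.+1%:R * f x + 2 * \sum_(y | halved_cube x y) f y.
Proof.
rewrite /flip_sum; under eq_bigr do under eq_bigr do rewrite flip_flip.
rewrite pair_bigA (bigID (fun p => p.1 == p.2)) /=; congr (_ + _).
  rewrite -(pair_big_dep xpredT (fun i j => i == j) (fun i j => f (flip i j x))) /=.
  have E i : \sum_(j | i == j) f (flip i j x) = f x.
    by rewrite (big_pred1 i) ?flip_id // => j; rewrite eq_sym.
  under eq_bigr do rewrite E.
  by rewrite sumr_const card_ord mulr_natl.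
rewrite (partition_big (fun p => flip p.1 p.2 x) xpredT) //= mulr_sumr big_mkcond.
rewrite [RHS]big_mkcond /=; apply: eq_bigr => y _.
under eq_bigr => p /andP[_ /eqP->] do [].
rewrite sumr_const.
have := card_flip_eq x y; rewrite cardsE => ->.
by case: (halved_cube x y); rewrite ?mulr0n ?mulr_natl.
Qed.

(** Each single move is an involution, so one can reindex by it. *)
Lemma flip_sum_symmetric (m : nat) (f g : even_word m.+1 -> rat) :
  \sum_x f x * flip_sum g x = \sum_x flip_sum f x * g x.
Proof.
rewrite /flip_sum; under eq_bigr do rewrite mulr_sumr.
under [RHS]eq_bigr do rewrite mulr_suml.
rewrite exchange_big [RHS]exchange_big /=; apply: eq_bigr => i _.
rewrite (reindex_inj (inv_inj (@flipK _ i ord_max))) /=.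
by apply: eq_bigr => x _; rewrite flipK.
Qed.

(** By symmetry the inner product of f with B^2 f is the sum of the squares of B f. *)
Lemma flip_sum_sqr_eq0 (m : nat) (f : even_word m.+1 -> rat) :
  (forall x, flip_sum (flip_sum f) x = 0) -> forall x, flip_sum f x = 0.
Proof.
move=> f0 x; have := flip_sum_symmetric f (flip_sum f).
rewrite big1 => [|y _]; last by rewrite f0 mulr0.
move/esym/psumr_eq0P => E; apply/eqP; rewrite -sqrf_eq0 expr2; apply/eqP.
by apply: E => // y _; rewrite -expr2 sqr_ge0.
Qed.

Lemma flip_sum_shift (m : nat) (b : rat) (f : even_word m.+1 -> rat)
    (x : even_word m.+1) :
  flip_sum (fun y => f y + b) x = flip_sum f x + m.+1%:R * b.
Proof. by rewrite /flip_sum big_split /= sumr_const card_ord mulr_natl. Qed.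

Definition indicator (V : finType) (A : {set V}) (x : V) : rat := (x \in A)%:R.

Lemma neighbors_inE (V : finType) (e : rel V) (x : V) (A : {set V}) :
  (neighbors_in e x A)%:R = \sum_(y | e x y) indicator A y.
Proof.
rewrite /neighbors_in -sum1_card natr_sum big_mkcond [RHS]big_mkcond.
by apply: eq_bigr => y _; rewrite inE /indicator; case: (y \in A); case: (e x y).
Qed.

(** * Deleting the last coordinate *)

Lemma tnth_delete_last (m : nat) (x : word m.+1) (k : 'I_m) :
  tnth (delete_last x) k = tnth x (widen_ord (leqnSn m) k).
Proof. by rewrite tnth_mktuple; congr (tnth x _); apply: val_inj. Qed.

(** Even parity determines the last bit from the others. *)
Lemma delete_last_inj (m : nat) :
  injective (fun x : even_word m.+1 => delete_last (val x)).
Proof.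
move=> x y xy.
have E k : tnth (val x) (widen_ord (leqnSn m) k) =
           tnth (val y) (widen_ord (leqnSn m) k).
  by rewrite -!tnth_delete_last xy.
apply: even_word_eqP => k.
have [km|mk] := ltnP k m.
  by have -> : k = widen_ord (leqnSn m) (Ordinal km) by apply: val_inj.
have -> : k = ord_max by apply/val_inj/eqP; rewrite eqn_leq mk -ltnS ltn_ord.
have := valP x; have := valP y; rewrite !odd_count_true !big_ord_recr /=.
under eq_bigr do rewrite -E.
by case: (\big[_/_]_(_ < _) _); do 2!case: (tnth _ _).
Qed.

Lemma delete_last_surj (m : nat) (u : word m) :
  exists x : even_word m.+1, delete_last (val x) = u.
Proof.
(* The appended bit is the parity of [u]. *)
set w := [tuple of rcons u (odd (count_mem true u))].
have w_even : ~~ odd (count_mem true w).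
  rewrite /= -cats1 count_cat /= addn0 oddD oddb.
  by rewrite eqb_id addbb.
exists (Sub w w_even); apply: eq_from_tnth => k.
by rewrite tnth_delete_last !(tnth_nth false) /= nth_rcons size_tuple ltn_ord.
Qed.

Lemma punctured_partition (m : nat) (C : 'I_2 -> {set even_word m.+1}) :
  ordered_2partition C -> ordered_2partition (punctured C).
Proof.
move=> [C_neq0 C_disj C_cover]; split.
- move=> i; have /set0Pn[x xC] := C_neq0 i; apply/set0Pn.
  by exists (delete_last (val x)); apply: imset_f.
- apply/pred0P => u /=; apply/andP => -[/imsetP[x x0 ->] /imsetP[y y1]].
  by move/delete_last_inj => xy; have := disjointFr C_disj x0; rewrite xy y1.
apply/setP => u; have [x <-] := delete_last_surj u.
rewrite !inE; have := in_setT x; rewrite -C_cover inE.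
by case/orP => xC; rewrite (imset_f (fun x => delete_last (val x)) xC) ?orbT.
Qed.

Lemma tnth_delete_last_flip (m : nat) (i : 'I_m) (x : even_word m.+1) (k : 'I_m) :
  tnth (delete_last (val (flip (widen_ord (leqnSn m) i) ord_max x))) k =
  tnth (delete_last (val x)) k (+) (k == i).
Proof.
rewrite !tnth_delete_last tnth_flip -!(inj_eq val_inj) /=.
by rewrite [k == m :> nat]ltn_eqF // addbF.
Qed.

Lemma cube_delete_lastP (m : nat) (x y : even_word m.+1) :
  reflect (exists i, y = flip (widen_ord (leqnSn m) i) ord_max x)
    (cube (delete_last (val x)) (delete_last (val y))).
Proof.
apply: (iffP cards1P) => -[i].
  move=> /setP D; exists i; apply/delete_last_inj/eq_from_tnth => k.
  rewrite tnth_delete_last_flip; have := D k; rewrite !inE => <-.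
  by do 2!case: (tnth _ _).
move=> ->; exists i; apply/setP => k.
by rewrite !inE tnth_delete_last_flip; case: (tnth _ _); case: (k == i).
Qed.

(** This is A = B - 1: the subtracted term is the move with [i = ord_max], which fixes [x]. *)
Lemma punctured_neighbors (m : nat) (A : {set even_word m.+1}) (x : even_word m.+1) :
  (neighbors_in (@cube m) (delete_last (val x)) [set delete_last (val y) | y in A])%:R =
  flip_sum (indicator A) x - indicator A x.
Proof.
rewrite /flip_sum big_ord_recr /= flip_id addrK.
pose e := [rel x y : even_word m.+1 | cube (delete_last (val x)) (delete_last (val y))].
have -> : neighbors_in (@cube m) (delete_last (val x)) [set delete_last (val y) | y in A] =
          neighbors_in e x A.
  rewrite /neighbors_in -[RHS](card_imset _ (@delete_last_inj m)); apply: eq_card => u.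
  rewrite inE; apply/andP/imsetP => [[/imsetP[y yA ->] xy]|[y]].
    by exists y; rewrite // inE yA.
  by rewrite inE => /andP[yA xy ->]; split => //; apply/imsetP; exists y.
rewrite neighbors_inE.
have inj_f : injective (fun i => flip (widen_ord (leqnSn m) i) ord_max x).
  move=> i j ij; have := tnth_delete_last_flip j x i.
  rewrite -ij tnth_delete_last_flip eqxx; case: eqVneq => // _.
  by case: (tnth _ _).
rewrite -(big_imset (indicator A) (in2W inj_f)) /=; apply: eq_bigl => y.
by apply/cube_delete_lastP/imsetP => [[i]|[i _]] ->; exists i.
Qed.

(** * Quotient matrices, their eigenvalues, and the degree *)

Lemma ord2_ind (P : 'I_2 -> Prop) : P 0 -> P 1 -> forall i, P i.
Proof.
move=> P0 P1 [[|[|[]]] // lt2].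
  by rewrite (_ : Ordinal lt2 = 0) //; apply: val_inj.
by rewrite (_ : Ordinal lt2 = 1) //; apply: val_inj.
Qed.

(** [S'] has trace n - 2 and determinant 1 - n, so S'^2 = (n - 2) S' + (n - 1) by
    Cayley-Hamilton. *)
Lemma punctured_quotient_sqr (n : nat) (c : int) :
  let S' := punctured_quotient n c in
  2^-1 *: (S' ^+ 2 - (n%:R - 1)%:M) + S' = (n%:R / 2) *: S'.
Proof.
apply/matrixP; do 2!elim/ord2_ind; rewrite expr2 !mxE !big_ord_recl big_ord0 !mxE /=;
  by field.
Qed.

(** Adding the two coordinates of v S = a v shows that those of v sum to 0, as [a != d]. So v is a
    multiple of (1, -1), and the first column gives [a]. *)
Lemma eigenvalue_row_sum (S : 'M[rat]_2) (d a : rat) :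
  (forall i, S i 0 + S i 1 = d) -> a != d ->
  eigenvalue S a -> S 0 0 - S 1 0 = a.
Proof.
move=> Sd ad /eigenvalueP[v vS v_neq0].
have E j : v 0 0 * S 0 j + v 0 1 * S 1 j = a * v 0 j.
  have /matrixP/(_ 0 j) := vS; rewrite !mxE !big_ord_recl big_ord0 addr0.
  by rewrite (_ : lift ord0 ord0 = 1) //; apply: val_inj.
have v1 : v 0 1 = - v 0 0.
  apply/eqP; rewrite -subr_eq0 opprK.
  have : (a - d) * (v 0 1 + v 0 0) = 0.
    rewrite -[X in a - X](Sd 0).
    have := E 0; have := E 1; have := Sd 0; have := Sd 1; nra.
  by move/eqP; rewrite mulf_eq0 subr_eq0 (negbTE ad).
have v0 : v 0 0 != 0.
  apply: contra v_neq0 => /eqP v0; apply/eqP/matrixP => i.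
  by elim/ord2_ind; rewrite ord1 mxE ?v1 v0 ?oppr0.
by apply: (mulfI v0); have := E 0; rewrite v1; lra.
Qed.

Lemma eigenvalue_scaled_punctured_quotient (n : nat) (c : int) :
  eigenvalue ((n%:R / 2) *: punctured_quotient n c) (- n%:R / 2).
Proof.
apply/eigenvalueP; exists (\row_j if j == 0 then 1 else -1).
  apply/matrixP => i; elim/ord2_ind; rewrite !mxE !big_ord_recl big_ord0 !mxE /=;
  by field.
by apply/eqP => /matrixP/(_ 0 0)/eqP; rewrite !mxE oner_eq0.
Qed.

(** Applying B^2 = 2 A' + n to the constant 1, which B multiplies by n, gives n^2 = 2 deg + n. *)
Lemma halved_cube_degree (m : nat) (x : even_word m.+1) :
  (neighbors_in (@halved_cube m.+1) x [set: even_word m.+1])%:R =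
  (m.+1%:R ^+ 2 - m.+1%:R) / 2 :> rat.
Proof.
have T1 y : flip_sum (indicator [set: even_word m.+1]) y = m.+1%:R.
  rewrite /flip_sum; under eq_bigr do rewrite /indicator in_setT.
  by rewrite sumr_const card_ord.
have := flip_sum_sqr (indicator [set: even_word m.+1]) x.
rewrite -neighbors_inE {1}/flip_sum; under eq_bigr do rewrite T1.
rewrite sumr_const card_ord -[X in X = _ -> _]mulr_natr {1}/indicator in_setT mulr1 => T2.
by move: (neighbors_in _ _ _) T2 => d; clear T1; lra.
Qed.

(** Supplies the integrality of the parameter [c] of [punctured_quotient]. *)
Lemma flip_sum_indicator_nat (m : nat) (A : {set even_word m.+1}) (x : even_word m.+1) :
  exists c : nat, flip_sum (indicator A) x = c%:R.
Proof.
exists (\sum_i (flip i ord_max x \in A))%N.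
by rewrite /flip_sum natr_sum.
Qed.

(** * Indicators of the two cells *)

Lemma cell_exists (V : finType) (C : 'I_2 -> {set V}) (x : V) :
  ordered_2partition C -> exists i, x \in C i.
Proof.
move=> [_ _ C_cover]; have := in_setT x; rewrite -C_cover inE.
by case/orP; [exists 0 | exists 1].
Qed.

Lemma indicator_cell (V : finType) (C : 'I_2 -> {set V}) (i j : 'I_2) (x : V) :
  ordered_2partition C -> x \in C i -> indicator (C j) x = (i == j)%:R.
Proof.
move=> [_ C_disj _] xi; rewrite /indicator; congr (nat_of_bool _)%:R.
elim/ord2_ind: i xi; elim/ord2_ind: j => // xi.
  by rewrite (disjointFr C_disj xi).
by rewrite (disjointFl C_disj xi).
Qed.

Lemma indicator_complement (V : finType) (C : 'I_2 -> {set V}) (x : V) :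
  ordered_2partition C -> indicator (C 1) x = 1 - indicator (C 0) x.
Proof.
move=> C_part; have [i xi] := cell_exists x C_part.
rewrite !(indicator_cell _ C_part xi).
by elim/ord2_ind: i xi => _ /=; rewrite ?subrr ?subr0.
Qed.

Lemma flip_sum_complement (m : nat) (C : 'I_2 -> {set even_word m.+1}) x :
  ordered_2partition C ->
  flip_sum (indicator (C 1)) x = m.+1%:R - flip_sum (indicator (C 0)) x.
Proof.
move=> C_part.
rewrite /flip_sum; under eq_bigr do rewrite indicator_complement //.
by rewrite sumrB sumr_const card_ord.
Qed.

(** * Both equitability conditions in terms of B *)

(** Adding the identity to [S'] makes both rows equal to (c, n - c), the values of B on the two
    indicators. *)
Lemma punctured_equitableP (m : nat) (C : 'I_2 -> {set even_word m.+1}) (c : int) :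
  ordered_2partition C ->
  equitable_2partition (@cube m) (punctured C) (punctured_quotient m.+1 c) <->
  forall x, flip_sum (indicator (C 0)) x = c%:~R.
Proof.
move=> C_part; split=> [[_ C_eq] x | Tc].
  have [i xi] := cell_exists x C_part.
  have := C_eq i 0 _ (imset_f (fun x => delete_last (val x)) xi).
  rewrite punctured_neighbors mxE => /eqP; rewrite subr_eq => /eqP->.
  rewrite (indicator_cell _ C_part xi).
  by elim/ord2_ind: i xi => /= _; rewrite ?subrK ?addr0.
split; first exact: punctured_partition.
move=> i j _ /imsetP[x xi ->]; rewrite punctured_neighbors mxE (indicator_cell _ C_part xi).
elim/ord2_ind: i xi => _; elim/ord2_ind: j => /=;
  by rewrite ?flip_sum_complement // Tc ?subr0.
Qed.

Lemma halved_equitable_flip_sum (m : nat) (C : 'I_2 -> {set even_word m.+1})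
    (S : 'M[rat]_2) :
  equitable_2partition (@halved_cube m.+1) C S ->
  S 0 0 - S 1 0 = - m.+1%:R / 2 ->
  forall x, flip_sum (indicator (C 0)) x = 2 * S 1 0 / m.+1%:R.
Proof.
move=> [C_part C_eq] S_ev x.
have n0 : m.+1%:R != 0 :> rat by rewrite pnatr_eq0.
pose k := 2 * S 1 0.
(* The value is n + 2 [S 0 0] on [C 0] and 2 [S 1 0] on [C 1]; the eigenvalue hypothesis makes them
   equal. *)
have T2 y : flip_sum (flip_sum (indicator (C 0))) y = k.
  rewrite flip_sum_sqr -neighbors_inE /k.
  have [i yi] := cell_exists y C_part.
  rewrite (C_eq i 0 y yi) (indicator_cell _ C_part yi).
  elim/ord2_ind: i yi => _ /=; lra.
(* B^2 multiplies constants by n^2, so this shift puts [f] in the kernel of B^2. *)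
pose f y := indicator (C 0) y + - (k / m.+1%:R ^+ 2).
have Tf y : flip_sum f y = flip_sum (indicator (C 0)) y + - (k / m.+1%:R).
  by rewrite flip_sum_shift; field; rewrite nat1r.
have TTf y : flip_sum (flip_sum f) y = 0.
  rewrite {1}/flip_sum; under eq_bigr do rewrite Tf.
  rewrite -/(flip_sum (fun y => flip_sum (indicator (C 0)) y + - (k / m.+1%:R)) y).
  by rewrite flip_sum_shift T2; field; rewrite nat1r.
by have := flip_sum_sqr_eq0 TTf x; rewrite Tf => /subr0_eq.
Qed.

Lemma flip_sum_const_halved_equitable (m : nat) (C : 'I_2 -> {set even_word m.+1})
    (c : int) :
  ordered_2partition C ->
  (forall x, flip_sum (indicator (C 0)) x = c%:~R) ->
  equitable_2partition (@halved_cube m.+1) C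
    ((m.+1%:R / 2) *: punctured_quotient m.+1 c).
Proof.
move=> C_part Tc; split=> // i j x xi; rewrite !mxE.
(* B maps each indicator to a constant, and a second B multiplies that constant by n. *)
have T2 k : flip_sum (flip_sum (indicator (C k))) x =
            m.+1%:R * flip_sum (indicator (C k)) x.
  have [a Ta] : exists a, forall y, flip_sum (indicator (C k)) y = a.
    elim/ord2_ind: k; first by exists c%:~R.
    by exists (m.+1%:R - c%:~R) => y; rewrite flip_sum_complement // Tc.
  by rewrite {1}/flip_sum; under eq_bigr do rewrite Ta; rewrite sumr_const card_ord Ta mulr_natl.
have := T2 j; rewrite flip_sum_sqr -neighbors_inE.
rewrite (indicator_cell _ C_part xi).
elim/ord2_ind: i xi => _; elim/ord2_ind: j => /=;
  rewrite ?flip_sum_complement // Tc; nra.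
Qed.

Theorem theorem2 (n : nat) (n_even : ~~ odd n)
    (C : 'I_2 -> {set even_word n}) (C_part : ordered_2partition C) :
  ordered_2partition (punctured C) /\
  forall S : 'M[rat]_2,
    (equitable_2partition (@halved_cube n) C S /\
     partition_eigenvalue (@halved_cube n) S (theta n n./2))
    <->
    exists c : int,
      let S' := punctured_quotient n c in
      equitable_2partition (@cube n.-1) (punctured C) S' /\
      S = 2^-1 *: (S' ^+ 2 - (n%:R - 1)%:M) + S'.
Proof.
rewrite theta_half //; case: n n_even C C_part => [|m] _ C C_part.
  (* For n = 0 there is a single word, which cannot fill two disjoint nonempty cells. *)
  have [C_neq0 C_disj _] := C_part.
  have /set0Pn[x x0] := C_neq0 0; have /set0Pn[y y1] := C_neq0 1.
  have xy : x = y by apply: even_word_eqP => -[].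
  by have := disjointFr C_disj x0; rewrite xy y1.
have n_gt0 : 0 < m.+1%:R :> rat by rewrite ltr0n.
split; first exact: punctured_partition.
move=> S; split=> [[C_eq [S_ev S_deg]]|[c [/(punctured_equitableP c C_part) Tc ->]]].
  have [/(_ _)/set0Pn C_neq0 _ _] := C_part; have [x1 x1C] := C_neq0 1.
  pose d : rat := (m.+1%:R ^+ 2 - m.+1%:R) / 2.
  have Sd i : S i 0 + S i 1 = d.
    have [x xC] := C_neq0 i; rewrite /d -(halved_cube_degree x) !neighbors_inE.
    rewrite -!(proj2 C_eq i _ x xC) !neighbors_inE -big_split /=.
    by apply: eq_bigr => y _; rewrite indicator_complement // addrC subrK /indicator in_setT.
  have S_diff : S 0 0 - S 1 0 = - m.+1%:R / 2.
    apply: (eigenvalue_row_sum Sd _ S_ev).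
    by have := S_deg x1; rewrite halved_cube_degree.
  have T := halved_equitable_flip_sum C_eq S_diff.
  have [c Tc] := flip_sum_indicator_nat (C 0) x1.
  have S10 : S 1 0 = m.+1%:R / 2 * c%:R by rewrite -Tc T; field; rewrite nat1r lt0r_neq0.
  exists c%:Z; split; first by apply/punctured_equitableP => // x; rewrite T -(T x1).
  rewrite punctured_quotient_sqr; apply/matrixP.
  have := Sd 0; have := Sd 1; rewrite /d expr2 => Sd1 Sd0.
  do 2!elim/ord2_ind; rewrite !mxE /= -?pmulrn; nra.
rewrite punctured_quotient_sqr; split; first exact: flip_sum_const_halved_equitable.
split; first exact: eigenvalue_scaled_punctured_quotient.
(* The eigenvalue is negative, whereas a degree is not. *)
move=> x; rewrite lt_eqF // (lt_le_trans _ (ler0n _ _)) //; lra.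
Qed.
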